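(* Let $(\Sigma,\partial)$ be a differential field whose field of constants $\mathbf{C}$ is algebraically closed and of characteristic zero. Let $L\in\Sigma[\partial]\setminus\mathbf{C}[\partial]$ be a third order operator with nontrivial centralizer $\mathcal{Z}(L)$, and let $\{1,A_1,A_2\}$ be any basis of $\mathcal{Z}(L)$ as a $\mathbf{C}[L]$-module. Then $$\mathcal{Z}(L)=\mathbf{C}[L,A_1,A_2]\simeq\frac{\mathbf{C}[\lambda,\mu_1,\mu_2]}{\mathrm{BC}(L)}.$$
   Context: $\Sigma[\partial]$ is the ring of differential operators with coefficients in $\Sigma$ ($\partial a=a\partial+\partial(a)$). $\mathcal{Z}(L)=\{A\in\Sigma[\partial]\mid LA=AL\}$ is the centralizer of $L$; it is a commutative domain, and it is called nontrivial if $\mathcal{Z}(L)\neq\mathbf{C}[L]$. In that case $\mathcal{Z}(L)$ is a free $\mathbf{C}[L]$-module of rank $3$; bases $\{1,A_1,A_2\}$ are taken with $A_i$ of minimal order among the elements of $\mathcal{Z}(L)$ of order congruent to $i$ modulo $3$. The Burchnall–Chaundy ideal of $L$ (with respect to the basis) is $\mathrm{BC}(L)=\{g\in\mathbf{C}[\lambda,\mu_1,\mu_2]\mid g(L,A_1,A_2)=0\}$, the kernel of the ring homomorphism $\mathbf{C}[\lambda,\mu_1,\mu_2]\to\Sigma[\partial]$, $\lambda\mapsto L$, $\mu_1\mapsto A_1$, $\mu_2\mapsto A_2$. *)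

(* Defs.v *)
From HB Require Import structures.
From mathcomp Require Import all_boot all_order all_algebra.
From mathcomp.multinomials Require Import mpoly.

Set Implicit Arguments.
Unset Strict Implicit.
Unset Printing Implicit Defensive.

Import GRing.Theory.
Local Open Scope ring_scope.

HB.mixin Record Field_isDifferential F of GRing.Field F := {
  der : F -> F;
  derD : {morph der : x y / x + y};
  derM : forall x y, der (x * y) = der x * y + x * der y
}.

#[short(type="diffFieldType")]
HB.structure Definition DiffField := {F of Field_isDifferential F & GRing.Field F}.

Section DiffFieldTheory.
Variable F : diffFieldType.
Implicit Types x y : F.

Lemma der0 : der (0 : F) = 0.
Proof. by apply: (@addrI _ (der 0)); rewrite -derD !addr0. Qed.

Lemma derN x : der (- x) = - der x.
Proof. by apply: (@addrI _ (der x)); rewrite -derD !subrr der0. Qed.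

Lemma derB : {morph (der : F -> F) : x y / x - y}.
Proof. by move=> x y; rewrite derD derN. Qed.

HB.instance Definition _ := GRing.isZmodMorphism.Build F F der derB.

Lemma der1 : der (1 : F) = 0.
Proof. by apply: (@addrI _ (der 1)); rewrite addr0 -{3}[1]mulr1 derM mulr1 mul1r. Qed.

Definition constant : {pred F} := [pred x | der x == 0].

Lemma constantP x : reflect (der x = 0) (x \in constant).
Proof. exact: eqP. Qed.

Lemma constant_divring_closed : divring_closed constant.
Proof.
split=> [|x y /constantP dx /constantP dy|x y /constantP dx /constantP dy];
  apply/constantP; first exact: der1.
  by rewrite derB dx dy subrr.
have [->|y0] := eqVneq y 0; first by rewrite invr0 mulr0 der0.
rewrite derM dx mul0r add0r.
suff -> : der y^-1 = 0 by rewrite mulr0.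
apply: (mulfI y0); rewrite mulr0.
by have := der1; rewrite -(mulfV y0) derM dy mul0r add0r.
Qed.

HB.instance Definition _ :=
  GRing.isDivringClosed.Build F constant constant_divring_closed.

End DiffFieldTheory.

Arguments constant {F}.

Record constants (F : diffFieldType) :=
  Constants { const_val : F; const_valP : const_val \in constant }.

HB.instance Definition _ (F : diffFieldType) := [isSub for @const_val F].
HB.instance Definition _ (F : diffFieldType) := [Choice of constants F by <:].
HB.instance Definition _ (F : diffFieldType) :=
  [SubChoice_isSubIntegralDomain of constants F by <:].
HB.instance Definition _ (F : diffFieldType) :=
  [SubIntegralDomain_isSubField of constants F by <:].

(** [Diffop p] stands for the sum of the p`_i ∂^i, with the coefficients
    written on the left of the powers of ∂.  The polynomial p only serves to
    hold the coefficients: its multiplication is not that of operators. *)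

Record diffop (F : diffFieldType) := Diffop { opcoef : {poly F} }.

HB.instance Definition _ (F : diffFieldType) := [isNew for @opcoef F].
HB.instance Definition _ (F : diffFieldType) := [Choice of diffop F by <:].

Section DiffopRing.
Variable F : diffFieldType.
Implicit Types (A B : diffop F) (p q r : {poly F}) (a b : F) (c : constants F).

Definition op_zero : diffop F := Diffop 0.
Definition op_opp A := Diffop (- opcoef A).
Definition op_add A B := Diffop (opcoef A + opcoef B).

Fact op_addA : associative op_add.
Proof. by move=> [p] [q] [r]; rewrite /op_add addrA. Qed.
Fact op_addC : commutative op_add.
Proof. by move=> [p] [q]; rewrite /op_add addrC. Qed.
Fact op_add0 : left_id op_zero op_add.
Proof. by move=> [p]; rewrite /op_add add0r. Qed.
Fact op_addN : left_inverse op_zero op_opp op_add.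
Proof. by move=> [p]; rewrite /op_add addNr. Qed.

HB.instance Definition _ :=
  GRing.isZmodule.Build (diffop F) op_addA op_addC op_add0 op_addN.

Lemma opcoef_inj : injective (@opcoef F).
Proof. exact: val_inj. Qed.

Lemma opcoefD A B : opcoef (A + B) = opcoef A + opcoef B.
Proof. by []. Qed.

(* Left multiplication by ∂, from ∂ (b ∂^j) = b ∂^(j+1) + ∂(b) ∂^j. *)
Definition der_mul p : {poly F} := p * 'X + map_poly der p.

Definition op_mul A B :=
  Diffop (\sum_(i < size (opcoef A)) (opcoef A)`_i *: iter i der_mul (opcoef B)).

Definition op_one : diffop F := Diffop 1.

Definition opscale c A := Diffop (val c *: opcoef A).

Lemma der_mul_is_zmod_morphism : zmod_morphism der_mul.
Proof. by move=> p q; rewrite /der_mul raddfB mulrBl /= addrACA opprD. Qed.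

HB.instance Definition _ :=
  GRing.isZmodMorphism.Build {poly F} {poly F} der_mul der_mul_is_zmod_morphism.

Lemma iter_der_mul_is_zmod_morphism i : zmod_morphism (iter i der_mul).
Proof. by elim: i => [//|i IH] p q; rewrite !iterS IH raddfB. Qed.

HB.instance Definition _ i := GRing.isZmodMorphism.Build {poly F} {poly F}
  (iter i der_mul) (iter_der_mul_is_zmod_morphism i).

Lemma der_mulZ a p : der_mul (a *: p) = a *: der_mul p + der a *: p.
Proof.
apply/polyP=> i; rewrite !(coefD, coefZ, coefMX, coef_map) /= derM.
case: eqP => _; rewrite ?mulr0 ?add0r ?mulrDr.
  by rewrite addrC.
by rewrite -addrA; congr (_ + _); rewrite addrC.
Qed.

Lemma op_mulE n A B : (size (opcoef A) <= n)%N ->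
  op_mul A B = Diffop (\sum_(i < n) (opcoef A)`_i *: iter i der_mul (opcoef B)).
Proof.
move=> le_n; congr Diffop.
rewrite (big_ord_widen _ (fun i => (opcoef A)`_i *: iter i der_mul (opcoef B)) le_n).
rewrite [RHS](bigID (fun i : 'I_n => i < size (opcoef A))%N) /= [X in _ + X]big1 ?addr0 //.
by move=> i; rewrite -leqNgt => /leq_sizeP -> //; rewrite scale0r.
Qed.

Fact op_mulDl : left_distributive op_mul +%R.
Proof.
move=> A B C; pose n := maxn (size (opcoef A)) (size (opcoef B)).
have leAB : (size (opcoef (A + B)%R) <= n)%N by apply: size_polyD.
have leA : (size (opcoef A) <= n)%N by apply: leq_maxl.
have leB : (size (opcoef B) <= n)%N by apply: leq_maxr.
rewrite (op_mulE _ leAB) (op_mulE _ leA) (op_mulE _ leB).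
apply: opcoef_inj; rewrite opcoefD /=.
by rewrite -big_split; apply: eq_bigr => i _; rewrite coefD scalerDl.
Qed.

Fact op_mulDr : right_distributive op_mul +%R.
Proof.
move=> A B C; apply: opcoef_inj; rewrite !opcoefD /=.
by rewrite -big_split; apply: eq_bigr => i _; rewrite /= raddfD scalerDr.
Qed.

Lemma op_mul0 A : op_mul 0 A = 0.
Proof. by rewrite /op_mul /= size_poly0 big_ord0. Qed.

Lemma op_mul_sum A n (f : 'I_n -> diffop F) :
  op_mul (\sum_(i < n) f i) A = \sum_(i < n) op_mul (f i) A.
Proof.
apply: (big_morph (fun B => op_mul B A)) => [B C|]; last exact: op_mul0.
exact: op_mulDl.
Qed.

Lemma opcoef_sum n (f : 'I_n -> diffop F) :
  opcoef (\sum_(i < n) f i) = \sum_(i < n) opcoef (f i).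
Proof. exact: (big_morph (@opcoef F)). Qed.

Lemma op_mulZl a p A : op_mul (Diffop (a *: p)) A =
  Diffop (a *: opcoef (op_mul (Diffop p) A)).
Proof.
rewrite (@op_mulE (size p)) ?size_scale_leq //; congr Diffop => /=.
by rewrite scaler_sumr; apply: eq_bigr => i _; rewrite coefZ scalerA.
Qed.

Lemma op_mul_der p A :
  op_mul (Diffop (der_mul p)) A = Diffop (der_mul (opcoef (op_mul (Diffop p) A))).
Proof.
have le1 : (size (p * 'X)%R <= (size p).+1)%N.
  by have [->|p0] := eqVneq p 0; rewrite ?mul0r ?size_poly0 ?size_mulX.
have le2 : (size (map_poly der p) <= size p)%N by apply: size_poly.
have -> : Diffop (der_mul p) = Diffop (p * 'X) + Diffop (map_poly der p) by [].
rewrite op_mulDl (@op_mulE (size p).+1) // (@op_mulE (size p) (Diffop (map_poly _ _))) //.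
apply: opcoef_inj; rewrite opcoefD /=.
rewrite big_ord_recl coefMX eqxx scale0r add0r -big_split raddf_sum.
by apply: eq_bigr => i _; rewrite /= coefMX coef_map der_mulZ.
Qed.

Fact op_mulA : associative op_mul.
Proof.
move=> A B C; rewrite [op_mul A B]/op_mul.
have -> : Diffop (\sum_(i < size (opcoef A))
    (opcoef A)`_i *: iter i der_mul (opcoef B)) =
    \sum_(i < size (opcoef A)) Diffop ((opcoef A)`_i *: iter i der_mul (opcoef B)).
  by apply: opcoef_inj; rewrite opcoef_sum.
rewrite op_mul_sum; apply: opcoef_inj.
rewrite opcoef_sum; apply: eq_bigr => i _; rewrite op_mulZl /=; congr (_ *: _).
elim: (i : nat) => [|k IH]; first by case: (B).
by rewrite !iterS IH -[RHS]/(opcoef (op_mul (Diffop (der_mul _)) C)) op_mul_der.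
Qed.

Fact op_mul1l : left_id op_one op_mul.
Proof.
by case=> p; rewrite /op_mul /= size_poly1 big_ord1 coef1 scale1r.
Qed.

Lemma iter_der_mul1 i : iter i der_mul 1 = 'X^i.
Proof.
elim: i => [//|i IH]; rewrite iterS IH /der_mul -exprSr.
suff -> : map_poly der 'X^i = 0 :> {poly F} by rewrite addr0.
apply/polyP=> j; rewrite coef_map coefXn coef0 /=.
by case: eqP => _; rewrite ?der1 ?der0.
Qed.

Fact op_mul1r : right_id op_one op_mul.
Proof.
case=> p; rewrite /op_mul /=; congr Diffop; rewrite -[RHS]coefK poly_def.
by apply: eq_bigr => i _; rewrite iter_der_mul1.
Qed.

Fact op_one_neq0 : op_one != 0.
Proof. by apply/eqP => -[/eqP]; rewrite oner_eq0. Qed.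

HB.instance Definition _ := GRing.Zmodule_isNzRing.Build (diffop F)
  op_mulA op_mul1l op_mul1r op_mulDl op_mulDr op_one_neq0.

Fact opscaleA c c' A : opscale c (opscale c' A) = opscale (c * c') A.
Proof. by rewrite /opscale /= scalerA. Qed.
Fact opscale1 : left_id 1 opscale.
Proof. by case=> p; rewrite /opscale /= scale1r. Qed.
Fact opscaleDr : right_distributive opscale +%R.
Proof. by move=> c A B; rewrite /opscale /= scalerDr. Qed.
Fact opscaleDl A : {morph opscale^~ A : c c' / c + c'}.
Proof. by move=> c c'; rewrite /opscale /= scalerDl. Qed.

HB.instance Definition _ := GRing.Zmodule_isLmodule.Build (constants F) (diffop F)
  opscaleA opscale1 opscaleDr opscaleDl.

Fact opscaleAl c A B : c *: (A * B) = (c *: A) * B.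
Proof. by case: A => p; rewrite [RHS]op_mulZl. Qed.

HB.instance Definition _ :=
  GRing.Lmodule_isLalgebra.Build (constants F) (diffop F) opscaleAl.

Lemma iter_der_mulZ i c p : iter i der_mul (val c *: p) = val c *: iter i der_mul p.
Proof.
elim: i => [//|i IH]; rewrite !iterS IH der_mulZ.
by rewrite (constantP _ (valP c)) scale0r addr0.
Qed.

Fact opscaleAr c A B : c *: (A * B) = A * (c *: B).
Proof.
congr Diffop; rewrite /= scaler_sumr; apply: eq_bigr => i _.
by rewrite iter_der_mulZ !scalerA mulrC.
Qed.

HB.instance Definition _ :=
  GRing.Lalgebra_isAlgebra.Build (constants F) (diffop F) opscaleAr.

Definition opconst a : diffop F := Diffop a%:P.
Definition opder : diffop F := Diffop 'X.

Lemma opder_opconst a : opder * opconst a = opconst a * opder + opconst (der a).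
Proof.
congr Diffop; rewrite /= size_polyX !big_ord_recl big_ord0 !coefX /=.
rewrite scale0r add0r addr0 scale1r /der_mul.
rewrite map_polyC /=; congr (_ + _).
rewrite size_polyC; have [->|a0] := eqVneq a 0; first by rewrite big_ord0 mul0r.
by rewrite big_ord1 coefC eqxx /= mul_polyC.
Qed.

Lemma opconstM a A : opconst a * A = Diffop (a *: opcoef A).
Proof.
rewrite /GRing.mul /= (@op_mulE 1) ?size_polyC ?leq_b1 //.
by rewrite big_ord1 coefC eqxx.
Qed.

Lemma opder_exp i : opder ^+ i = Diffop 'X^i.
Proof.
elim: i => [//|i IH]; rewrite exprS IH; congr Diffop.
rewrite /= size_polyX !big_ord_recl big_ord0 !coefX /=.
by rewrite scale0r add0r addr0 scale1r -!iter_der_mul1 -iterS.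
Qed.

Lemma diffopE A :
  A = \sum_(i < size (opcoef A)) opconst (opcoef A)`_i * opder ^+ i.
Proof.
apply: opcoef_inj; rewrite opcoef_sum -[LHS]coefK poly_def; apply: eq_bigr => i _.
by rewrite opder_exp opconstM.
Qed.

End DiffopRing.

Section Centralizer.
Variable F : diffFieldType.
Implicit Types A L : diffop F.

(* The order of 0 is 0 by convention. *)
Definition op_order A : nat := (size (opcoef A)).-1.

(* Membership in C[∂]. *)
Definition const_coef : {pred diffop F} :=
  [pred A | opcoef A \is a polyOver constant].

Definition centralizer L : {pred diffop F} := [pred A | L * A == A * L].

Lemma centralizer_subalg_closed L : subalg_closed (centralizer L).
Proof.
split=> [|c A B|A B]; rewrite !inE ?mulr1 ?mul1r //.
  by move=> /eqP cA /eqP cB; rewrite mulrDr mulrDl -scalerAr -scalerAl cA cB.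
by move=> /eqP cA /eqP cB; rewrite mulrA cA -mulrA cB mulrA.
Qed.

HB.instance Definition _ L := GRing.isSubalgClosed.Build (constants F) (diffop F)
  (centralizer L) (centralizer_subalg_closed L).

(* The C-subalgebra C[s] of Σ[∂] generated by the family s. *)
Inductive gen_subalg (s : seq (diffop F)) : diffop F -> Prop :=
| gen_const c : gen_subalg s c%:A
| gen_mem A of A \in s : gen_subalg s A
| gen_add A B of gen_subalg s A & gen_subalg s B : gen_subalg s (A + B)
| gen_mul A B of gen_subalg s A & gen_subalg s B : gen_subalg s (A * B).

Definition nontrivial_centralizer L :=
  ~ (forall A, A \in centralizer L <-> gen_subalg [:: L] A).

(* {1, A1, A2} is a basis of the C[L]-module Z(L). *)
Definition centralizer_basis L A1 A2 : Prop :=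
  [/\ A1 \in centralizer L, A2 \in centralizer L,
      forall A, A \in centralizer L -> exists P0 P1 P2,
        [/\ gen_subalg [:: L] P0, gen_subalg [:: L] P1, gen_subalg [:: L] P2
          & A = P0 + P1 * A1 + P2 * A2]
    & forall P0 P1 P2,
        gen_subalg [:: L] P0 -> gen_subalg [:: L] P1 -> gen_subalg [:: L] P2 ->
        P0 + P1 * A1 + P2 * A2 = 0 -> [/\ P0 = 0, P1 = 0 & P2 = 0]].

(* g(L, A1, A2), where the variables 'X_0, 'X_1, 'X_2 are λ, μ1, μ2.  As Σ[∂]
   is not commutative, mmap fixes an order of the factors: L, then A1, then A2.
   This is a ring morphism when L, A1 and A2 commute with each other. *)
Definition bc_eval L A1 A2 (g : {mpoly (constants F)[3]}) : diffop F :=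
  mmap (in_alg (diffop F)) (tnth [tuple L; A1; A2]) g.

Definition BC L A1 A2 : {pred {mpoly (constants F)[3]}} :=
  [pred g | bc_eval L A1 A2 g == 0].

End Centralizer.

Arguments const_coef {F}.

Record centralizer_ring (F : diffFieldType) (L : diffop F) :=
  CentralizerRing { cent_val : diffop F; cent_valP : cent_val \in centralizer L }.

HB.instance Definition _ (F : diffFieldType) (L : diffop F) :=
  [isSub for @cent_val F L].
HB.instance Definition _ (F : diffFieldType) (L : diffop F) :=
  [Choice of centralizer_ring L by <:].
HB.instance Definition _ (F : diffFieldType) (L : diffop F) :=
  [SubChoice_isSubAlgebra of centralizer_ring L by <:].

(* Main.v *)
Require Import Defs.
From HB Require Import structures.
From mathcomp Require Import all_boot all_order all_algebra.
From mathcomp.multinomials Require Import mpoly.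

(** Everything rests on the commutativity of Z(L), which is a matter of rank
    only.  Let K be a central subring of a ring without zero divisors that has
    1, a1, a2 as a K-basis, and expand a1^2 in this basis.  If a2 occurs, then
    a nonzero multiple of a2 lies in K[a1], so a2 commutes with a1.  Otherwise
    a1^2 = p0 + p1 a1 and p1 - a1 is the conjugate of a1.  The expansion
    a1 a2 = q0 + q1 a1 + q2 a2 says that (a1 - q2) a2 is in K[a1];
    multiplication by the conjugate of a1 - q2 turns the left-hand side into a
    multiple of a2 by a norm, which is a nonzero element of K, and a2 commutes
    with a1 again.  This is [rank3_commute].  Here the ring is Z(L) and K is
    C[L]: operators have no zero divisors because leading coefficients multiply
    ([diffop_integral]), and C[L] commutes with all of Z(L).

    Since A1 and A2 commute with L and with each other, and Z(L) is spanned by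
    1, A1, A2 over C[L], the ring Z(L) is C[L, A1, A2] and is commutative.
    Evaluation at (L, A1, A2) is therefore a ring morphism onto Z(L), with
    kernel BC(L), and the isomorphism is that of [first_isomorphism]. *)

Set Implicit Arguments.
Unset Strict Implicit.
Unset Printing Implicit Defensive.

Import GRing.Theory.
Local Open Scope ring_scope.
Local Open Scope quotient_scope.

(** * Rings of rank three over a central subring *)

Section RankThree.
Variable S : nzRingType.
Hypothesis S_integral : forall x y : S, x * y = 0 -> x = 0 \/ y = 0.

Lemma commute_cancel (p a b : S) : p != 0 -> GRing.comm a p ->
  GRing.comm a (p * b) -> GRing.comm a b.
Proof.
move=> p0 cap capb; apply/eqP; rewrite -subr_eq0; apply/eqP.
have /S_integral[/eqP|//] : p * (a * b - b * a) = 0.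
  by rewrite mulrBr mulrA -cap -mulrA capb mulrA subrr.
by rewrite (negPf p0).
Qed.

(** Whether or not a2 occurs in the expansion of a1^2, some nonzero p in K makes
    p a2 a polynomial in a1 over K, and [commute_cancel] removes p. *)
Lemma rank3_commute (K : S -> Prop) (a1 a2 : S) :
    K 1 -> (forall x y, K x -> K y -> K (x - y)) ->
    (forall x y, K x -> GRing.comm y x) ->
    (forall x, exists p0 p1 p2,
       [/\ K p0, K p1, K p2 & x = p0 + p1 * a1 + p2 * a2]) ->
    (forall p0 p1 p2, K p0 -> K p1 -> K p2 ->
       p0 + p1 * a1 + p2 * a2 = 0 -> [/\ p0 = 0, p1 = 0 & p2 = 0]) ->
  GRing.comm a1 a2.
Proof.
move=> K1 KB Kcent span indep.
have K0 : K 0 by rewrite -(subrr 1); apply: KB.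
have KN1 : K (- 1) by rewrite -sub0r; apply: KB.
have [p0 [p1 [p2 [Kp0 Kp1 Kp2 a1a1]]]] := span (a1 * a1).
have [p2_0 | p2_neq0] := eqVneq p2 0; last first.
  apply: (commute_cancel p2_neq0); first exact: Kcent.
  have -> : p2 * a2 = a1 * a1 - (p0 + p1 * a1) by rewrite a1a1 addrC addKr.
  by apply: commrB; [apply: commrM | apply: commrD; [|apply: commrM]];
    by [apply: Kcent | ].
have {p2_0}a1a1 : a1 * a1 = p0 + p1 * a1 by rewrite a1a1 p2_0 mul0r addr0.
have [q0 [q1 [q2 [Kq0 Kq1 Kq2 a1a2]]]] := span (a1 * a2).
pose u := p1 - a1 - q2.
have cq2 x : GRing.comm x q2 by exact: Kcent.
(* p1 - a1 is the conjugate of a1, so u is the conjugate of a1 - q2 and the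
   right-hand side is its norm. *)
have normE : u * (a1 - q2) = q2 * q2 - p1 * q2 - p0.
  rewrite /u mulrBr !mulrBl a1a1 (cq2 a1) opprD addrCA subrr addr0.
  by rewrite !opprB addrCA [- p0 - _ + _]addrA subrK -addrA (addrC (- p0)).
have u_a2 : (q2 * q2 - p1 * q2 - p0) * a2 = u * (q0 + q1 * a1).
  by rewrite -normE -mulrA [(a1 - q2) * a2]mulrBl a1a2 addrK.
(* Were the norm zero, a1 or its conjugate would be q2, a relation between 1
   and a1. *)
have [norm0 | norm_neq0] := eqVneq (q2 * q2 - p1 * q2 - p0) 0.
  have /S_integral[u0 | a1q2] : u * (a1 - q2) = 0 by rewrite normE.
    have [] := indep (p1 - q2) (- 1) 0; rewrite ?mulN1r ?mul0r ?addr0 //.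
    + exact: KB.
    + by rewrite addrAC.
    by move=> _ /eqP; rewrite oppr_eq0 oner_eq0.
  have [] := indep (0 - q2) 1 0; rewrite ?mul1r ?mul0r ?addr0 ?sub0r //.
  + by rewrite -sub0r; apply: KB.
  + by rewrite addrC.
  by move=> _ /eqP; rewrite oner_eq0.
have a1u : GRing.comm a1 u by do 2!apply: commrB => //; exact: Kcent.
apply: (commute_cancel norm_neq0); last rewrite u_a2.
  by rewrite -normE; apply: commrM => //; apply: commrB.
apply: commrM => //; apply: commrD; first exact: Kcent.
by apply: commrM => //; apply: Kcent.
Qed.

End RankThree.

(** * The first isomorphism theorem *)

(** Surjectivity is a statement about the boolean equality, so that preimages can
    be picked by the choice operator of R to invert f. *)
Lemma first_isomorphism (R : comNzRingType) (S : nzRingType)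
    (g : {rmorphism R -> S}) : (forall y, exists x, g x == y) ->
  exists2 I : idealr R, I =i [pred x | g x == 0] &
    exists2 f : {rmorphism {ideal_quot I} -> S}, bijective f &
      forall x, f (\pi_{ideal_quot I} x) = g x.
Proof.
move=> g_onto; pose ker : {pred R} := [pred x | g x == 0].
have ker_closed : idealr_closed ker.
  split=> [||a u v]; rewrite !inE ?rmorph0 ?rmorph1 ?oner_eq0 //.
  by move=> /eqP gu /eqP gv; rewrite rmorphD rmorphM gu gv mulr0 addr0.
pose I : idealr R := HB.pack ker (isIdealr.Build R ker ker_closed).
exists I => //; pose f (x : {ideal_quot I}) := g (repr x).
have fE x : f (\pi_{ideal_quot I} x) = g x.
  apply/eqP; rewrite /f -subr_eq0 -rmorphB.
  by have := Quotient.idealrBE I (repr (\pi_{ideal_quot I} x)) x; rewrite reprK eqxx.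
have fB : zmod_morphism f.
  by move=> x y; rewrite -[x]reprK -[y]reprK -rmorphB !fE rmorphB.
have fM : monoid_morphism f.
  split=> [|x y]; first by rewrite -(rmorph1 (\pi_{ideal_quot I})) fE rmorph1.
  by rewrite -[x]reprK -[y]reprK -rmorphM !fE rmorphM.
pose fR : {rmorphism {ideal_quot I} -> S} := HB.pack f
  (GRing.isZmodMorphism.Build {ideal_quot I} S f fB)
  (GRing.isMonoidMorphism.Build {ideal_quot I} S f fM).
exists fR => //; exists (fun y => \pi_{ideal_quot I} (xchoose (g_onto y))) => y.
  apply/eqP; rewrite -[y in _ == y]reprK -Quotient.idealrBE.
  by rewrite inE rmorphB subr_eq0 (eqP (xchooseP (g_onto _))).
by rewrite /= fE; apply/eqP/(xchooseP (g_onto y)).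
Qed.

(** * Differential operators have no zero divisors *)

Section DiffopIntegral.
Variable F : diffFieldType.
Implicit Types (p : {poly F}) (A B : diffop F).

(** In ∂ p the term p X has the top degree, and the derivative of the
    coefficients does not reach it. *)
Lemma size_lead_iter_der_mul i p : p != 0 ->
  size (iter i (@der_mul F) p) = (i + size p)%N /\
  lead_coef (iter i (@der_mul F) p) = lead_coef p.
Proof.
move=> p0; elim: i => [//|i [sz lc]]; rewrite iterS.
set q := iter i _ p in sz lc *.
have q0 : q != 0 by rewrite -lead_coef_eq0 lc lead_coef_eq0.
have lt_q : (size (map_poly der q) < size (q * 'X)%R)%N.
  by rewrite size_mulX // ltnS size_poly.
by rewrite /der_mul size_polyDl // lead_coefDl // size_mulX // lead_coefMX sz lc.
Qed.

(** The coefficient of A B in degree ord A + ord B comes only from the leading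
    terms, and it is the product of the leading coefficients. *)
Lemma diffop_integral A B : A * B = 0 -> A = 0 \/ B = 0.
Proof.
have [-> | A0] := eqVneq A 0; first by left.
have [-> | B0 /(congr1 (@opcoef F))/=] := eqVneq B 0; first by right.
have a0 : opcoef A != 0 by apply: contra_neq A0 => a0; apply: opcoef_inj.
have b0 : opcoef B != 0 by apply: contra_neq B0 => b0; apply: opcoef_inj.
have ltA : (0 < size (opcoef A))%N by rewrite size_poly_gt0.
move/(congr1 (fun p : {poly F} => p`_((size (opcoef A)).-1 + (size (opcoef B)).-1))).
rewrite coef0 coef_sum -(prednK ltA) big_ord_recr /= big1 ?add0r => [|i _].
  have [sz lc] := size_lead_iter_der_mul (size (opcoef A)).-1 b0.
  rewrite coefZ; move: lc; rewrite /lead_coef sz.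
  rewrite -{1 2}(@prednK (size (opcoef B))) ?size_poly_gt0 // addnS /= => ->.
  by move/eqP; rewrite mulf_eq0 -!lead_coefE !lead_coef_eq0 (negPf a0) (negPf b0).
have [sz _] := size_lead_iter_der_mul i b0.
rewrite coefZ [X in _ * X]nth_default ?mulr0 // sz.
by rewrite -(@prednK (size (opcoef B))) ?size_poly_gt0 // addnS /= ltn_add2r.
Qed.

End DiffopIntegral.

(** * Commutativity of the centralizer *)

Section Centralizer.
Variables (F : diffFieldType) (L : diffop F).
Implicit Types (A B : diffop F) (s : seq (diffop F)).

Lemma gen_subalg_commute s A B : gen_subalg s B ->
  {in s, forall X, GRing.comm A X} -> GRing.comm A B.
Proof.
move=> gB cAs; elim: gB => [c|X /cAs //|X Y _ cX _ cY|X Y _ cX _ cY].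
- by rewrite /GRing.comm -scalerAl -scalerAr mulr1 mul1r.
- exact: commrD.
- exact: commrM.
Qed.

Lemma gen_subalg_centralizer s A :
  {subset s <= centralizer L} -> gen_subalg s A -> A \in centralizer L.
Proof.
move=> sZ; elim=> [c|X /sZ //|X Y _ ZX _ ZY|X Y _ ZX _ ZY].
- by rewrite rpredZ ?rpred1.
- exact: rpredD.
- exact: rpredM.
Qed.

Lemma gen_subalgB s A B :
  gen_subalg s A -> gen_subalg s B -> gen_subalg s (A - B).
Proof.
move=> gA gB; apply: gen_add => //; rewrite -mulN1r; apply: gen_mul => //.
by have := gen_const s (- 1); rewrite scaleN1r.
Qed.

Lemma centralizer_ring_integral (x y : centralizer_ring L) :
  x * y = 0 -> x = 0 \/ y = 0.
Proof.
move=> /(congr1 val); rewrite rmorphM rmorph0 => /diffop_integral.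
by case=> xy0; [left | right]; apply: val_inj; rewrite xy0 rmorph0.
Qed.

(** [rank3_commute] is applied inside Z(L), where C[L] is central; it need
    not be so among all operators. *)
Lemma basis_commute A1 A2 : centralizer_basis L A1 A2 -> GRing.comm A1 A2.
Proof.
move=> [ZA1 ZA2 span indep].
have LZ : {subset [:: L] <= centralizer L}.
  by move=> X; rewrite mem_seq1 => /eqP->; rewrite !inE.
pose a1 : centralizer_ring L := CentralizerRing ZA1.
pose a2 : centralizer_ring L := CentralizerRing ZA2.
suff /(congr1 val) : a1 * a2 = a2 * a1 by rewrite !rmorphM.
apply: (rank3_commute centralizer_ring_integral
  (K := fun x => gen_subalg [:: L] (val x))).
- by rewrite rmorph1 -(scale1r 1); apply: gen_const.
- by move=> x y Kx Ky; rewrite rmorphB; apply: gen_subalgB.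
- move=> x y Kx; apply: val_inj; rewrite !rmorphM.
  apply: (gen_subalg_commute Kx) => X; rewrite mem_seq1 => /eqP->.
  by have := cent_valP y; rewrite !inE => /eqP.
- move=> x; have [P0 [P1 [P2 [g0 g1 g2 xE]]]] := span _ (cent_valP x).
  exists (CentralizerRing (gen_subalg_centralizer LZ g0)).
  exists (CentralizerRing (gen_subalg_centralizer LZ g1)).
  exists (CentralizerRing (gen_subalg_centralizer LZ g2)).
  by split=> //; apply: val_inj.
- move=> p0 p1 p2 g0 g1 g2 /(congr1 val)/(indep _ _ _ g0 g1 g2)[P0 P1 P2].
  by split; apply: val_inj.
Qed.

Lemma basis_generates A1 A2 : centralizer_basis L A1 A2 ->
  forall A, A \in centralizer L <-> gen_subalg [:: L; A1; A2] A.
Proof.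
move=> [ZA1 ZA2 span _] A; split=> [/span[P0 [P1 [P2 [g0 g1 g2 ->]]]] | ].
  have sub P : gen_subalg [:: L] P -> gen_subalg [:: L; A1; A2] P.
    elim=> [c|X|X Y _ gX _ gY|X Y _ gX _ gY].
    - exact: gen_const.
    - by rewrite mem_seq1 => /eqP->; apply: gen_mem; rewrite mem_head.
    - exact: gen_add.
    - exact: gen_mul.
  have gA1 : gen_subalg [:: L; A1; A2] A1.
    by apply: gen_mem; rewrite !inE eqxx orbT.
  have gA2 : gen_subalg [:: L; A1; A2] A2.
    by apply: gen_mem; rewrite !inE eqxx !orbT.
  apply: gen_add; last by apply: gen_mul => //; apply: sub.
  by apply: gen_add; [apply: sub | apply: gen_mul => //; apply: sub].
apply: gen_subalg_centralizer => X; rewrite !inE.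
by case/or3P=> /eqP-> //; move: ZA1 ZA2; rewrite !inE.
Qed.

(** The generators L, A1, A2 of Z(L) commute pairwise, hence with everything they
    generate, hence so do any two elements of Z(L). *)
Lemma centralizer_commute A1 A2 (x y : centralizer_ring L) :
  centralizer_basis L A1 A2 -> GRing.comm x y.
Proof.
move=> basis; have [ZA1 ZA2 _ _] := basis.
have gen z := (basis_generates basis _).1 (cent_valP z).
have cA := basis_commute basis.
have cL (z : centralizer_ring L) : GRing.comm (val z) L.
  by apply/esym/eqP; have := cent_valP z; rewrite !inE.
have cA1 (z : centralizer_ring L) : GRing.comm A1 (val z).
  apply: (gen_subalg_commute (gen z)) => X; rewrite !inE.
  by case/or3P=> /eqP->; rewrite /GRing.comm //; move: ZA1; rewrite inE => /eqP.
have cA2 (z : centralizer_ring L) : GRing.comm A2 (val z).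
  apply: (gen_subalg_commute (gen z)) => X; rewrite !inE.
  by case/or3P=> /eqP->; rewrite /GRing.comm //; move: ZA2; rewrite inE => /eqP.
apply: val_inj; rewrite !rmorphM; apply: (gen_subalg_commute (gen y)) => X.
by rewrite !inE => /or3P[] /eqP->; [exact: cL | |]; apply: commr_sym; [exact: cA1 | exact: cA2].
Qed.

End Centralizer.

(** * The coordinate ring of the spectral curve *)

Theorem theorem3p8 (F : diffFieldType)
    (closedC : GRing.closed_field_axiom (constants F))
    (char0C : [pchar constants F] =i pred0)
    (L : diffop F) (ordL : op_order L = 3%N) (L_nconst : L \notin const_coef)
    (ntZL : nontrivial_centralizer L)
    (A1 A2 : diffop F) (basisZL : centralizer_basis L A1 A2) :
  (forall A : diffop F,
     A \in centralizer L <-> gen_subalg [:: L; A1; A2] A) /\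
  exists2 I : idealr {mpoly (constants F)[3]}, I =i BC L A1 A2 &
    exists2 f : {rmorphism {ideal_quot I} -> centralizer_ring L}, bijective f &
      forall g : {mpoly (constants F)[3]},
        cent_val (f (\pi_{ideal_quot I} g)) = bc_eval L A1 A2 g.
Proof.
have gens := basis_generates basisZL; split=> //.
(* The evaluation takes values in Z(L), where the images of the variables are
   central; they need not be so in the ring of all operators, and multiplicativity
   of mmap is a consequence of their centrality. *)
set Z := centralizer_ring L.
have Zgen i : tnth [tuple L; A1; A2] i \in centralizer L.
  by apply/gens/gen_mem; exact: mem_tnth.
pose h i : Z := CentralizerRing (Zgen i).
pose ev := mmap (in_alg Z) h.
have evE g : cent_val (ev g) = bc_eval L A1 A2 g.
  rewrite -[LHS]/(val (ev g)) /ev /bc_eval /mmap rmorph_sum.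
  apply: eq_bigr => m _; rewrite rmorphM /= /mmap1; congr (_ * _).
  rewrite -[LHS]/(val _) rmorph_prod; apply: eq_bigr => i _.
  by rewrite rmorphXn.
have evM : monoid_morphism ev.
  suff [] : multiplicative ev by [].
  apply: commr_mmap_is_multiplicative => *; exact: centralizer_commute basisZL.
pose evR : {rmorphism {mpoly (constants F)[3]} -> Z} := HB.pack ev
  (GRing.isZmodMorphism.Build {mpoly (constants F)[3]} Z ev
     (mmap_is_additive h (in_alg Z)))
  (GRing.isMonoidMorphism.Build {mpoly (constants F)[3]} Z ev evM).
have ev_onto (y : Z) : exists g, evR g == y.
  suff [g gE] : exists g, bc_eval L A1 A2 g = cent_val y.
    by exists g; apply/eqP/val_inj; rewrite -[LHS]/(cent_val (ev g)) evE gE.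
  have:= (gens _).1 (cent_valP y).
  elim=> {y} [c|X /tnthP[i ->]|X Y _ [g <-] _ [g' <-]|X Y _ [g <-] _ [g' <-]].
  - by exists c%:MP; rewrite /bc_eval mmapC.
  - by exists 'X_i; rewrite /bc_eval mmapX mmap1U.
  - by exists (g + g'); rewrite -!evE -[LHS]/(val (evR _)) !rmorphD.
  - by exists (g * g'); rewrite -!evE -[LHS]/(val (evR _)) !rmorphM.
have [I IE [f f_bij fE]] := first_isomorphism ev_onto.
exists I; last by exists f => // g; rewrite fE evE.
by move=> g; rewrite IE !inE -evE -val_eqE.
Qed.
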